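(* Let $X$ be a real Hilbert space and let $C := \{(x,y)\in X\times X : \langle x,y\rangle = 0\}$. Then $C$ is proximinal, i.e., $P_C(x_0,y_0)\neq\varnothing$ for every $(x_0,y_0)\in X\times X$. Moreover, let $(x_0,y_0)\in X\times X$. Then exactly one of the following three cases occurs. (i) $\langle x_0,y_0\rangle = 0$, $\tfrac12 d_C^2(x_0,y_0)=0$, and $P_C(x_0,y_0)=\{(x_0,y_0)\}$. (ii) $\langle x_0,y_0\rangle\neq 0$, $x_0\neq y_0$ and $x_0\neq -y_0$, $$P_C(x_0,y_0)=\left\{\frac{1}{1-\lambda^2}\big(x_0-\lambda y_0,\;y_0-\lambda x_0\big)\right\},$$ and $$\tfrac12 d_C^2(x_0,y_0)=\tfrac12\lambda\langle x_0,y_0\rangle=\frac{\|x_0\|^2+\|y_0\|^2-\|x_0+y_0\|\,\|x_0-y_0\|}{4},$$ where $$\lambda:=\frac{\|x_0\|^2+\|y_0\|^2-\|x_0+y_0\|\,\|x_0-y_0\|}{2\langle x_0,y_0\rangle}\notin\{-1,1\}.$$ (iii) $\langle x_0,y_0\rangle\neq 0$, $x_0=y_0$ or $x_0=-y_0$, $\tfrac12 d_C^2(x_0,y_0)=\tfrac14\big(\|x_0\|^2+\|y_0\|^2\big)$, and $$P_C(x_0,y_0)=\{(0,y_0)\}\cup\big\{(0,y_0)+\big(\langle u,x_0\rangle u,\,-\langle u,y_0\rangle u\big) : u\in\mathbb{S}\big\}$$ is not a singleton, where $\mathbb{S}=\{z\in X : \|z\|=1\}$ is the unit sphere of $X$.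
   Context: $X\times X$ is the product Hilbert space with inner product $\langle (x,y),(u,v)\rangle=\langle x,u\rangle+\langle y,v\rangle$ and induced norm. The distance function is $d_C(x_0,y_0)=\inf_{(x,y)\in C}\|(x,y)-(x_0,y_0)\|$, and $P_C(x_0,y_0)$ is the set of all $(x,y)\in C$ with $\|(x,y)-(x_0,y_0)\|=d_C(x_0,y_0)$ (set-valued projection). *)

(* Defs.v *)
From mathcomp Require Import all_boot all_order all_algebra.
From mathcomp Require Import all_classical all_reals all_analysis.

Set Implicit Arguments.
Unset Strict Implicit.
Unset Printing Implicit Defensive.

Import Order.TTheory GRing.Theory Num.Theory.
Import numFieldNormedType.Exports.

Local Open Scope classical_set_scope.
Local Open Scope ring_scope.

(* A real Hilbert space is a complete normed module [X] over a [realType]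
   together with a symmetric positive definite bilinear form
   [dot : {dot X for idfun}] such that [norm_induced_by dot] holds. *)
Definition norm_induced_by (R : realType) (X : completeNormedModType R)
    (dot : {dot X for idfun}) : Prop :=
  forall x : X, `|x| = Num.sqrt (dot x x).

Section ProductHilbert.
Context {R : realType} {X : completeNormedModType R} (dot : {dot X for idfun}).
Implicit Types (p q z : X * X) (C : set (X * X)).

(* The canonical norm of the library on [X * X] is the maximum norm, hence the
   Hilbert norm on the product has to be introduced separately. *)
Definition prod_dot p q : R := dot p.1 q.1 + dot p.2 q.2.

Definition prod_norm p : R := Num.sqrt (prod_dot p p).

Definition dist_set C z : R := inf [set prod_norm (p - z) | p in C].

Definition proj_set C z : set (X * X) :=
  [set p | C p /\ prod_norm (p - z) = dist_set C z].

Definition proximinal C : Prop := forall z, proj_set C z !=set0.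

Definition orth_pairs : set (X * X) := [set p | dot p.1 p.2 = 0].

End ProductHilbert.

Definition exactly_one3 (A B C : Prop) : Prop :=
  [\/ A, B | C] /\ [/\ ~ (A /\ B), ~ (A /\ C) & ~ (B /\ C)].

(* Main.v *)
(* Put a = |x0 + y0| and b = |x0 - y0|.  In the coordinates s = x + y,
   t = x - y the orthogonality of x and y says |s| = |t| =: r, so by
   Cauchy-Schwarz the squared distance from (x, y) to (x0, y0) is at least
     ((r - a)^2 + (r - b)^2) / 2 = ((a - b) / 2)^2 + (r - (a + b) / 2)^2.
   Equality forces r = (a + b) / 2 and the equality case of Cauchy-Schwarz,
   which determines s and t as soon as a, b <> 0.  When y0 = k x0 with
   k = 1 or k = -1, an orthogonal pair (x, y) is a projection if and only if
   x + k y = x0. *)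
Require Import Defs.
From mathcomp Require Import all_boot all_order all_algebra.
From mathcomp Require Import all_classical all_reals all_analysis.
From mathcomp Require Import ring lra.

Set Implicit Arguments.
Unset Strict Implicit.

Import Order.TTheory GRing.Theory Num.Theory.
Import numFieldNormedType.Exports.
Local Open Scope classical_set_scope.
Local Open Scope ring_scope.

(** Half the sum of [x + y] and [x - y] is [x]; with [x] and [y] exchanged, the same lemma recovers
    [y]. *)
Lemma addsub_scale (R : numFieldType) (V : lmodType R) (c d : R)
    (x y x0 y0 : V) :
  x + y = c *: (x0 + y0) -> x - y = d *: (x0 - y0) ->
  x = ((c + d) / 2) *: x0 + ((c - d) / 2) *: y0.
Proof.
move=> hs ht.
have -> : x = 2^-1 *: ((x + y) + (x - y)).
  rewrite addrACA subrr addr0 -[x + x]mulr2n -[x *+ 2]scaler_nat scalerA.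
  by rewrite mulVf ?scale1r ?pnatr_eq0.
rewrite hs ht (scalerDr c) (scalerBr d) addrACA -scalerBl -scalerDl scalerDr.
by rewrite !scalerA ![2^-1 * _]mulrC.
Qed.

(** * Inner product calculus and Cauchy-Schwarz with its equality case *)

Section RealInnerProduct.
Context {R : realType} {X : completeNormedModType R} (dot : {dot X for idfun}).
Implicit Types (u v w x y : X) (k : R).

Lemma dotC u v : dot u v = dot v u.
Proof. by rewrite hermC /= expr0 mul1r. Qed.

Lemma dotDl u v w : dot (u + v) w = dot u w + dot v w.
Proof. exact: linearDl. Qed.

Lemma dotNl u w : dot (- u) w = - dot u w.
Proof. exact: linearNl. Qed.

Lemma dotZl k u w : dot (k *: u) w = k * dot u w.
Proof. exact: linearZl_LR. Qed.

Lemma dotDr u v w : dot w (u + v) = dot w u + dot w v.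
Proof. exact: linearDr. Qed.

Lemma dotNr u w : dot w (- u) = - dot w u.
Proof. exact: linearNr. Qed.

Lemma dotZr k u w : dot w (k *: u) = k * dot w u.
Proof. by rewrite dotC dotZl dotC. Qed.

Definition dotE := (dotDl, dotNl, dotZl, dotDr, dotNr, dotZr).

Context (hdot : norm_induced_by dot).

Lemma dot_ge0 u : 0 <= dot u u.
Proof.
rewrite leNgt; apply/negP => d0.
(* [Num.sqrt] is 0 at negative arguments, so a negative [dot u u] would force [u = 0] and hence
   [dot u u = 0]. *)
have := hdot u; rewrite (ler0_sqrtr (ltW d0)) => /normr0_eq0 u0.
by rewrite u0 linear0l ltxx in d0.
Qed.

Lemma sqr_norm_dot u : `|u| ^+ 2 = dot u u.
Proof. by rewrite hdot sqr_sqrtr ?dot_ge0. Qed.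

Lemma dot_eq0 u : dot u u = 0 -> u = 0.
Proof.
by rewrite -sqr_norm_dot => /eqP; rewrite sqrf_eq0 normr_eq0 => /eqP.
Qed.

(** Expresses the Cauchy-Schwarz defect through a square: positivity then gives the inequality,
    definiteness its equality case. *)
Lemma dot_norm_sub u v :
  dot (`|u| *: v - `|v| *: u) (`|u| *: v - `|v| *: u) =
  2 * (`|u| * `|v|) * (`|u| * `|v| - dot u v).
Proof. rewrite !dotE -!sqr_norm_dot (dotC v u); ring. Qed.

Lemma dot_le_norm u v : dot u v <= `|u| * `|v|.
Proof.
have [->|u0] := eqVneq u 0; first by rewrite linear0l normr0 mul0r.
have [->|v0] := eqVneq v 0; first by rewrite linear0r normr0 mulr0.
have uv0 : 0 < 2 * (`|u| * `|v|) by rewrite !mulr_gt0 ?normr_gt0.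
by rewrite -subr_ge0 -(pmulr_rge0 _ uv0) -dot_norm_sub dot_ge0.
Qed.

Lemma dot_eq_norm u v : dot u v = `|u| * `|v| -> `|u| *: v = `|v| *: u.
Proof.
move=> uv; apply/eqP; rewrite -subr_eq0; apply/eqP/dot_eq0.
by rewrite dot_norm_sub uv subrr mulr0.
Qed.

(** * Sums and differences of orthogonal pairs; the minimal squared distance *)

Lemma orth_norm_addsub x y : dot x y = 0 -> `|x + y| = `|x - y|.
Proof.
by move=> xy; rewrite !hdot !dotE (dotC y x) xy; congr Num.sqrt; ring.
Qed.

Lemma dot_polarization x y : 4 * dot x y = `|x + y| ^+ 2 - `|x - y| ^+ 2.
Proof. rewrite !sqr_norm_dot !dotE (dotC y x); ring. Qed.

Lemma parallelogram_sum x y :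
  2 * (`|x| ^+ 2 + `|y| ^+ 2) = `|x + y| ^+ 2 + `|x - y| ^+ 2.
Proof. rewrite !sqr_norm_dot !dotE (dotC y x); ring. Qed.

(* Since [r = `|x - y|], the last two summands are Cauchy-Schwarz defects. *)
Lemma orth_dist_decomp x y x0 y0 (r := `|x + y|) : dot x y = 0 ->
  dot (x - x0) (x - x0) + dot (y - y0) (y - y0) =
  ((`|x0 + y0| - `|x0 - y0|) / 2) ^+ 2
  + ((r - (`|x0 + y0| + `|x0 - y0|) / 2) ^+ 2
     + (r * `|x0 + y0| - dot (x + y) (x0 + y0))
     + (r * `|x0 - y0| - dot (x - y) (x0 - y0))).
Proof.
move=> xy.
have hr : r ^+ 2 = dot x x + dot y y.
  by rewrite /r sqr_norm_dot !dotE (dotC y x) xy addr0 add0r.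
have hxy := parallelogram_sum x0 y0; rewrite !sqr_norm_dot in hxy.
have e1 := sqr_norm_dot (x0 + y0); have e2 := sqr_norm_dot (x0 - y0).
rewrite -e1 -e2 in hxy.
rewrite !dotE (dotC x0 x) (dotC y0 y).
have -> : dot x x = r ^+ 2 - dot y y by rewrite hr addrK.
have -> : dot x0 x0 = (`|x0 + y0| ^+ 2 + `|x0 - y0| ^+ 2) / 2 - dot y0 y0.
  by rewrite -hxy; field.
by field.
Qed.

Lemma orth_dist_ge x y x0 y0 : dot x y = 0 ->
  ((`|x0 + y0| - `|x0 - y0|) / 2) ^+ 2 <=
  dot (x - x0) (x - x0) + dot (y - y0) (y - y0).
Proof.
move=> xy; rewrite (orth_dist_decomp _ _ xy) lerDl.
apply: addr_ge0; last by rewrite subr_ge0 (orth_norm_addsub xy) dot_le_norm.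
by apply: addr_ge0; rewrite ?sqr_ge0 ?subr_ge0 ?dot_le_norm.
Qed.

(** The three nonnegative terms that [orth_dist_decomp] adds to the minimum must all vanish.
    Multiplying by [a] and [b] rather than dividing keeps the conclusion meaningful when one of them
    is 0. *)
Lemma orth_dist_attained_eq x y x0 y0
    (a := `|x0 + y0|) (b := `|x0 - y0|) : dot x y = 0 ->
  dot (x - x0) (x - x0) + dot (y - y0) (y - y0) = ((a - b) / 2) ^+ 2 ->
  a *: (x + y) = ((a + b) / 2) *: (x0 + y0) /\
  b *: (x - y) = ((a + b) / 2) *: (x0 - y0).
Proof.
move=> xy; rewrite (orth_dist_decomp _ _ xy) -/a -/b.
have h1 := dot_le_norm (x + y) (x0 + y0).
have h2 := dot_le_norm (x - y) (x0 - y0).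
rewrite -(orth_norm_addsub xy) -/a -/b in h1 h2.
have h3 := sqr_ge0 (`|x + y| - (a + b) / 2) => h.
have /eqP : (`|x + y| - (a + b) / 2) ^+ 2 = 0 by lra.
rewrite sqrf_eq0 subr_eq0 => /eqP hr.
have e1 : dot (x + y) (x0 + y0) = `|x + y| * `|x0 + y0| by rewrite -/a; lra.
have e2 : dot (x - y) (x0 - y0) = `|x - y| * `|x0 - y0|.
  by rewrite -(orth_norm_addsub xy) -/b; lra.
by rewrite -hr {2}(orth_norm_addsub xy) -(dot_eq_norm e1) -(dot_eq_norm e2).
Qed.

Lemma orth_dist_attained_ex x0 y0 : exists x y, dot x y = 0 /\
  dot (x - x0) (x - x0) + dot (y - y0) (y - y0) =
  ((`|x0 + y0| - `|x0 - y0|) / 2) ^+ 2.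
Proof.
(* If [x0 + y0] or [x0 - y0] is 0, the quotients below break down, but [(0, y0)] attains the
   bound. *)
have [xy|a0] := eqVneq (x0 + y0) 0.
  exists 0, y0; split; first exact: linear0l.
  have -> : y0 = - x0 by apply/eqP; rewrite -addr_eq0 addrC xy.
  rewrite !opprK sub0r addNr subrr normr0 -mulr2n normrMn linear0l addr0.
  by rewrite !dotE -sqr_norm_dot; field.
have [xy|b0] := eqVneq (x0 - y0) 0.
  exists 0, y0; split; first exact: linear0l.
  have -> : y0 = x0 by apply/esym/eqP; rewrite -subr_eq0 xy.
  rewrite !subrr normr0 sub0r -mulr2n normrMn linear0l addr0.
  by rewrite !dotE -sqr_norm_dot; field.
rewrite -normr_eq0 in a0; rewrite -normr_eq0 in b0.
have hd := dot_polarization x0 y0; have hp := parallelogram_sum x0 y0.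
have ex := sqr_norm_dot x0; have ey := sqr_norm_dot y0.
set a := `|x0 + y0| in a0 hd hp *; set b := `|x0 - y0| in b0 hd hp *.
(* These coefficients solve the equality conditions of [orth_dist_attained_eq], namely x + y = (a +
   b)/(2a) (x0 + y0) and x - y = (a + b)/(2b) (x0 - y0). *)
pose al := (a + b) ^+ 2 / (4 * a * b).
pose be := (a ^+ 2 - b ^+ 2) / (4 * a * b).
have {}hd : dot x0 y0 = (a ^+ 2 - b ^+ 2) / 4 by lra.
have {}hp : dot x0 x0 = (a ^+ 2 + b ^+ 2) / 2 - dot y0 y0 by lra.
exists (al *: x0 - be *: y0), (al *: y0 - be *: x0).
rewrite !dotE !(dotC y0 x0) hd hp /al /be; split; by field; rewrite a0 b0.
Qed.

(** * Distance and projection onto the set of orthogonal pairs *)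

Lemma dist_orth_pairs x0 y0 :
  dist_set dot (orth_pairs dot) (x0, y0) =
  `|(`|x0 + y0| - `|x0 - y0|) / 2|.
Proof.
(* The absolute value is the root of the bound in [orth_dist_ge]. An attaining pair gives one
   inequality and, for the other, nonemptiness of the set of distances. *)
rewrite /dist_set -sqrtr_sqr; apply/eqP; rewrite eq_le; apply/andP; split.
  have [x [y [xy e]]] := orth_dist_attained_ex x0 y0.
  rewrite -e; apply: ge_inf; last by exists (x, y).
  by exists 0 => _ [p _ <-]; exact: sqrtr_ge0.
apply: lb_le_inf.
  have [x [y [xy _]]] := orth_dist_attained_ex x0 y0.
  by exists (prod_norm dot ((x, y) - (x0, y0))), (x, y).
by move=> _ [[x y] /= xy <-]; exact/ler_wsqrtr/orth_dist_ge.
Qed.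

Lemma sqr_dist_orth_pairs x0 y0 :
  dist_set dot (orth_pairs dot) (x0, y0) ^+ 2 =
  ((`|x0 + y0| - `|x0 - y0|) / 2) ^+ 2.
Proof. by rewrite dist_orth_pairs real_normK ?num_real. Qed.

(** Removes the infimum and the square roots; the descriptions of projections below all rest on this
    form. *)
Lemma proj_orth_pairsE x0 y0 x y :
  proj_set dot (orth_pairs dot) (x0, y0) (x, y) <->
  dot x y = 0 /\
  dot (x - x0) (x - x0) + dot (y - y0) (y - y0) =
  ((`|x0 + y0| - `|x0 - y0|) / 2) ^+ 2.
Proof.
rewrite /proj_set /orth_pairs /= dist_orth_pairs -sqrtr_sqr.
rewrite /prod_norm /prod_dot.
split=> -[xy e]; split=> //; last by rewrite e.
by apply/eqP; rewrite -eqr_sqrt ?addr_ge0 ?dot_ge0 ?sqr_ge0 //; exact/eqP.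
Qed.

Lemma proximinal_orth_pairs : proximinal dot (orth_pairs dot).
Proof.
move=> [x0 y0]; have [x [y h]] := orth_dist_attained_ex x0 y0.
by exists (x, y); apply/proj_orth_pairsE.
Qed.

Lemma proj_orth_pairs_orth x0 y0 : dot x0 y0 = 0 ->
  proj_set dot (orth_pairs dot) (x0, y0) = [set (x0, y0)].
Proof.
move=> xy; apply/seteqP; split=> [[x y]|_ ->].
  move=> /proj_orth_pairsE[_].
  rewrite (orth_norm_addsub xy) subrr mul0r expr0n /=.
  have h1 := dot_ge0 (x - x0); have h2 := dot_ge0 (y - y0) => h.
  have /dot_eq0/eqP : dot (x - x0) (x - x0) = 0 by lra.
  have /dot_eq0/eqP : dot (y - y0) (y - y0) = 0 by lra.
  by rewrite !subr_eq0 => /eqP-> /eqP->.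
apply/proj_orth_pairsE; split=> //.
by rewrite (orth_norm_addsub xy) !subrr linear0l addr0 mul0r expr0n.
Qed.

(** With a, b nonzero the equality conditions can be divided by them, which determines x + y and x -
    y. For [l = (a - b) / (a + b)] the scalar factor is 1/(1 - l^2). *)
Lemma proj_orth_pairs_eq1 x0 y0 (a := `|x0 + y0|) (b := `|x0 - y0|) :
  a != 0 -> b != 0 ->
  proj_set dot (orth_pairs dot) (x0, y0) =
  [set ((a + b) ^+ 2 / (4 * a * b)) *:
       (x0 - ((a - b) / (a + b)) *: y0, y0 - ((a - b) / (a + b)) *: x0)].
Proof.
move=> a0 b0; set p := (_ *: _).
have ab0 : a + b != 0 by rewrite paddr_eq0 ?normr_ge0 // (negbTE a0).
have sub q : proj_set dot (orth_pairs dot) (x0, y0) q -> q = p.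
  case: q => x y /proj_orth_pairsE[xy /(orth_dist_attained_eq xy)].
  rewrite -/a -/b => -[hs ht].
  have {}hs : x + y = (a^-1 * ((a + b) / 2)) *: (x0 + y0).
    by rewrite -scalerA -hs scalerA mulVf // scale1r.
  have {}ht : x - y = (b^-1 * ((a + b) / 2)) *: (x0 - y0).
    by rewrite -scalerA -ht scalerA mulVf // scale1r.
  have ht' : y - x = (b^-1 * ((a + b) / 2)) *: (y0 - x0).
    by rewrite -opprB ht -scalerN opprB.
  have hs' : y + x = (a^-1 * ((a + b) / 2)) *: (y0 + x0).
    by rewrite (addrC y) (addrC y0).
  rewrite (addsub_scale hs ht) (addsub_scale hs' ht').
  apply: (f_equal2 pair); rewrite scalerBr scalerA -scaleNr;
    by congr (_ *: _ + _ *: _); field; rewrite ?a0 ?b0 ?ab0.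
apply/seteqP; split=> [q /sub -> //|_ ->].
(* The reverse inclusion comes from proximinality: some projection exists, and it must be [p]. *)
by have [q hq] := proximinal_orth_pairs (x0, y0); rewrite -(sub q hq).
Qed.

(** * The case y0 = k x0, where k^2 = 1 covers both signs at once *)

Lemma sqr_dist_orth_pairs_parallel k x0 : k ^+ 2 = 1 ->
  ((`|x0 + k *: x0| - `|x0 - k *: x0|) / 2) ^+ 2 = `|x0| ^+ 2.
Proof.
move=> /eqP; rewrite sqrf_eq1 => /orP[]/eqP->.
  by rewrite scale1r subrr normr0 -mulr2n normrMn; field.
by rewrite scaleN1r opprK subrr normr0 -mulr2n normrMn; field.
Qed.

(** For orthogonal x, y the squared distance exceeds |x0|^2 by exactly |x + k y - x0|^2. *)
Lemma proj_orth_pairs_parallelE k x0 x y : k ^+ 2 = 1 ->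
  proj_set dot (orth_pairs dot) (x0, k *: x0) (x, y) <->
  dot x y = 0 /\ x + k *: y = x0.
Proof.
move=> k1; rewrite proj_orth_pairsE sqr_dist_orth_pairs_parallel //.
have e : dot x y = 0 ->
    dot (x - x0) (x - x0) + dot (y - k *: x0) (y - k *: x0) - `|x0| ^+ 2 =
    dot (x + k *: y - x0) (x + k *: y - x0).
  move=> xy; rewrite sqr_norm_dot !dotE (dotC y x) (dotC x0 x) (dotC x0 y) xy.
  by ring: k1.
split=> -[xy h]; split=> //; have {}e := e xy.
  by move: e; rewrite h subrr => /esym/dot_eq0/eqP; rewrite subr_eq0 => /eqP.
by apply/eqP; rewrite -subr_eq0 e h subrr linear0l.
Qed.

(** By [proj_orth_pairs_parallelE], x and k y split x0 into orthogonal parts, so a nonzero x is the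
    orthogonal projection of x0 onto the line it spans. The point with x = 0 stands apart: in
    dimension one no unit vector is orthogonal to a nonzero x0. *)
Lemma proj_orth_pairs_parallel k x0 : k ^+ 2 = 1 ->
  proj_set dot (orth_pairs dot) (x0, k *: x0) =
  [set (0, k *: x0)] `|`
    [set (0, k *: x0) + (dot u x0 *: u, - (dot u (k *: x0) *: u)) |
      u in [set u : X | `|u| = 1]].
Proof.
move=> k1; have kk v : k *: (k *: v) = v by rewrite scalerA -expr2 k1 scale1r.
apply/seteqP; split=> [[x y] /(proj_orth_pairs_parallelE _ _ _ k1)[xy h]|q].
  have [x_eq0|x0N] := eqVneq x 0.
    by left; rewrite /= -h x_eq0 add0r kk.
  have nx : `|x| != 0 by rewrite normr_eq0.
  have hy : y = k *: x0 - k *: x by rewrite -scalerBr -h addrAC subrr add0r kk.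
  have hxx : dot x x0 = `|x| ^+ 2.
    by rewrite -h sqr_norm_dot dotDr dotZr xy mulr0 addr0.
  right; exists (`|x|^-1 *: x) => /=.
    by rewrite normrZ normfV normr_id mulVf.
  rewrite !dotZl dotZr hxx !scalerA; apply: (f_equal2 pair); rewrite /= ?add0r.
    by rewrite (_ : _ * _ = 1) ?scale1r //; field.
  by rewrite hy; congr (_ - _ *: _); field.
case=> [->|[u /= u1 <-]].
  by apply/(proj_orth_pairs_parallelE _ _ _ k1); rewrite linear0l add0r kk.
apply/(proj_orth_pairs_parallelE _ _ _ k1); rewrite add0r; split.
  by rewrite !dotE -sqr_norm_dot u1 expr1n; ring.
by rewrite dotZr scalerDr kk scalerN scalerA mulrA -expr2 k1 mul1r addrC subrK.
Qed.

Lemma proj_orth_pairs_parallel_nsing k x0 : k ^+ 2 = 1 -> x0 != 0 ->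
  ~ exists p, proj_set dot (orth_pairs dot) (x0, k *: x0) = [set p].
Proof.
move=> k1 x0N [p hp].
(* Two extreme splittings of [x0], distinct because [x0] is nonzero. *)
have : proj_set dot (orth_pairs dot) (x0, k *: x0) (x0, 0).
  by apply/(proj_orth_pairs_parallelE _ _ _ k1); rewrite linear0r scaler0 addr0.
have : proj_set dot (orth_pairs dot) (x0, k *: x0) (0, k *: x0).
  apply/(proj_orth_pairs_parallelE _ _ _ k1).
  by rewrite linear0l scalerA -expr2 k1 scale1r add0r.
by rewrite hp /= => <- [/eqP]; rewrite (negbTE x0N).
Qed.

End RealInnerProduct.

(** * The trichotomy for the projection *)

Theorem theorem4p4 (R : realType) (X : completeNormedModType R)
    (dot : {dot X for idfun}) (hdot : norm_induced_by dot) :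
  let C : set (X * X) := orth_pairs dot in
  let d : X * X -> R := dist_set dot C in
  let P : X * X -> set (X * X) := proj_set dot C in
  proximinal dot C /\
  forall x0 y0 : X,
  let lambda : R :=
    (`|x0| ^+ 2 + `|y0| ^+ 2 - `|x0 + y0| * `|x0 - y0|) / (2 * dot x0 y0) in
  exactly_one3
    [/\ dot x0 y0 = 0,
        2^-1 * d (x0, y0) ^+ 2 = 0
      & P (x0, y0) = [set (x0, y0)]]
    [/\ [/\ dot x0 y0 <> 0, x0 <> y0 & x0 <> - y0],
        P (x0, y0) =
          [set (1 - lambda ^+ 2)^-1 *: (x0 - lambda *: y0, y0 - lambda *: x0)],
        2^-1 * d (x0, y0) ^+ 2 = 2^-1 * lambda * dot x0 y0,
        2^-1 * lambda * dot x0 y0 =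
          (`|x0| ^+ 2 + `|y0| ^+ 2 - `|x0 + y0| * `|x0 - y0|) / 4
      & lambda \notin [:: -1; 1]]
    [/\ dot x0 y0 <> 0 /\ (x0 = y0 \/ x0 = - y0),
        2^-1 * d (x0, y0) ^+ 2 = 4^-1 * (`|x0| ^+ 2 + `|y0| ^+ 2),
        P (x0, y0) = [set (0, y0)] `|`
          [set (0, y0) + (dot u x0 *: u, - (dot u y0 *: u)) |
            u in [set u : X | `|u| = 1]]
      & ~ exists p : X * X, P (x0, y0) = [set p]].
Proof.
move=> C d P; split; first exact: proximinal_orth_pairs.
move=> x0 y0 lambda; split; last first.
  split.
  - by case=> -[xy0 _ _] [[xyN _ _] _ _ _ _].
  - by case=> -[xy0 _ _] [[xyN _] _ _ _].
  - by case=> -[[_ neq neqN] _ _ _ _] [[_ [eq|eqN]] _ _ _].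
have [xy|/eqP xy] := eqVneq (dot x0 y0) 0.
  apply: Or31; split=> //; last exact: proj_orth_pairs_orth.
  rewrite /d sqr_dist_orth_pairs // (orth_norm_addsub hdot xy).
  by rewrite subrr mul0r expr0n mulr0.
have [[k [k1 kE]]|ne] := pselect (exists k : R, k ^+ 2 = 1 /\ y0 = k *: x0).
  have x0N : x0 != 0 by apply/eqP => x00; apply: xy; rewrite x00 linear0l.
  apply: Or33; rewrite /P /d sqr_dist_orth_pairs // kE; split.
  - split; first by rewrite -kE.
    move/eqP: k1; rewrite sqrf_eq1 => /orP[]/eqP->.
      by left; rewrite scale1r.
    by right; rewrite scaleN1r opprK.
  - rewrite sqr_dist_orth_pairs_parallel //.
    rewrite normrZ exprMn real_normK ?num_real // k1; by field.
  - exact: proj_orth_pairs_parallel.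
  - exact: proj_orth_pairs_parallel_nsing.
have nep : x0 <> y0.
  by move=> e; apply: ne; exists 1; rewrite expr1n scale1r.
have nem : x0 <> - y0.
  by move=> e; apply: ne; exists (-1); rewrite sqrrN expr1n scaleN1r e opprK.
have hd := dot_polarization hdot x0 y0; have hp := parallelogram_sum hdot x0 y0.
have a0 : `|x0 + y0| != 0 by rewrite normr_eq0 addr_eq0; exact/eqP.
have b0 : `|x0 - y0| != 0 by rewrite normr_eq0 subr_eq0; exact/eqP.
have PE := proj_orth_pairs_eq1 hdot a0 b0.
have dE := sqr_dist_orth_pairs hdot x0 y0.
have ab0 : `|x0 + y0| + `|x0 - y0| != 0.
  by rewrite paddr_eq0 ?normr_ge0 // (negbTE a0).
(* With a = |x0 + y0| and b = |x0 - y0|, the numerator of [lambda] is (a - b)^2 / 2 and its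
   denominator (a^2 - b^2) / 2; the factor a - b cancels since [dot x0 y0] is nonzero. *)
have lE : lambda = (`|x0 + y0| - `|x0 - y0|) / (`|x0 + y0| + `|x0 - y0|).
  have amb0 : `|x0 + y0| - `|x0 - y0| != 0.
    by apply/eqP => h; apply: xy; move: hd; rewrite subr_sqr h; lra.
  rewrite /lambda.
  have -> : `|x0| ^+ 2 + `|y0| ^+ 2 =
      (`|x0 + y0| ^+ 2 + `|x0 - y0| ^+ 2) / 2 by lra.
  have -> : 2 * dot x0 y0 =
     (`|x0 + y0| - `|x0 - y0|) * (`|x0 + y0| + `|x0 - y0|) / 2 by lra.
  by field; rewrite amb0 ab0.
have ldE : 2^-1 * lambda * dot x0 y0 =
    (`|x0| ^+ 2 + `|y0| ^+ 2 - `|x0 + y0| * `|x0 - y0|) / 4.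
  by rewrite /lambda; field; exact/eqP.
have l2E : 1 - lambda ^+ 2 =
    4 * `|x0 + y0| * `|x0 - y0| / (`|x0 + y0| + `|x0 - y0|) ^+ 2.
  by rewrite lE; field.
apply: Or32; split=> //.
- by rewrite l2E invf_div lE; exact: PE.
- rewrite ldE /d dE; lra.
(* Both a and b are nonzero here, so 1 - lambda^2 = 4ab/(a + b)^2 cannot vanish. *)
- have l2N : 1 - lambda ^+ 2 != 0.
    by rewrite l2E !mulf_neq0 ?invr_neq0 ?expf_neq0 ?pnatr_eq0.
  apply: contra l2N; rewrite !inE subr_eq0.
  by rewrite [_ == lambda ^+ 2]eq_sym sqrf_eq1 orbC.
Qed.
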